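(* Let $X$ be an infinite set, let $P(X)$ be the $\sigma$-algebra of all subsets of $X$, let $x_0\in X$, and let $\mu=\delta_{x_0}$ be the Dirac measure on $P(X)$ at $x_0$. Let $\mathcal{I}$ be the set of all ideals $I$ of the ring $\mathcal{M}(X,P(X))$ such that $\delta_{x_0}(E)>0$ (i.e. $x_0\in E$) for each $E\in Z[I]$. Then for any two ideals $I$ and $J$ in $\mathcal{I}$, $I\sim J$ and also $I\approx J$. Here $I\sim J$ means that the $m_{\mu_I}$-topology equals the $m_{\mu_J}$-topology on $\mathcal{M}(X,P(X))$, and $I\approx J$ means that the $U_{\mu_I}$-topology equals the $U_{\mu_J}$-topology on $\mathcal{M}(X,P(X))$.
   Context: $\delta_{x_0}:P(X)\to\{0,1\}$ is given by $\delta_{x_0}(E)=1$ if $x_0\in E$ and $\delta_{x_0}(E)=0$ if $x_0\notin E$. $\mathcal{M}(X,P(X))$ is the commutative ring with unity of all real-valued ($P(X)$-measurable, hence all) functions on $X$, with pointwise operations. For $g\in\mathcal{M}(X,P(X))$, $Z(g)=\{x\in X: g(x)=0\}$, and for an ideal $I$, $Z[I]=\{Z(g): g\in I\}$. $U_{\mu_I}^+$ is the set of all $u\in\mathcal{M}(X,P(X))$ for which there exist $Z\in Z[I]$ and $E\subseteq Z$ with $\mu(E)=0$ such that $u(x)>0$ for all $x\in Z\setminus E$. For $f\in\mathcal{M}(X,P(X))$ and $u\in U_{\mu_I}^+$, $m_{\mu_I}(f,u)$ is the set of all $g\in\mathcal{M}(X,P(X))$ for which there exist $Z\in Z[I]$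 and $E\subseteq Z$ with $\mu(E)=0$ such that $|g(x)-f(x)|<u(x)$ for all $x\in Z\setminus E$. The sets $m_{\mu_I}(f,u)$ form an open base for a topology on $\mathcal{M}(X,P(X))$, called the $m_{\mu_I}$-topology. For $f\in\mathcal{M}(X,P(X))$ and real $\epsilon>0$, $U_{\mu_I}(f,\epsilon)$ is the set of all $g\in\mathcal{M}(X,P(X))$ such that $\sup_{x\in Z\setminus E}|f(x)-g(x)|<\epsilon$ for some $Z\in Z[I]$ and some $E\subseteq Z$ with $\mu(E)=0$ (the supremum is taken in $[0,\infty]$). The sets $U_{\mu_I}(f,\epsilon)$ form an open base for a topology on $\mathcal{M}(X,P(X))$, called the $U_{\mu_I}$-topology. *)

(* Defs.v *)
From HB Require Import structures.
From mathcomp Require Import all_boot all_order all_algebra.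
From mathcomp Require Import all_classical all_reals all_analysis.
From mathcomp Require Import measurable_realfun.
Set Implicit Arguments.
Unset Strict Implicit.
Unset Printing Implicit Defensive.
Import Order.TTheory GRing.Theory Num.Theory.
Import numFieldNormedType.Exports.
Local Open Scope classical_set_scope.
Local Open Scope ring_scope.

(* Not necessarily proper, unlike [idealr] of ring_quotient. *)
Record ideal (A : comPzRingType) := Ideal {
  ideal_set :> set A ;
  ideal_0 : ideal_set 0 ;
  ideal_D : forall a b, ideal_set a -> ideal_set b -> ideal_set (a + b) ;
  ideal_M : forall a b, ideal_set b -> ideal_set (a * b) }.

(* X with the sigma-algebra P(X); every function on it is measurable. *)
Definition power_space (X : Type) : Type := X.

HB.instance Definition _ (X : pointedType) := Pointed.on (power_space X).
HB.instance Definition _ (X : pointedType) :=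
  @isMeasurable.Build default_measure_display (power_space X)
    discrete_measurable discrete_measurable0
    discrete_measurableC discrete_measurableU.

Section zero_sets.
Context d (T : measurableType d) (R : realType).
Local Notation M := {mfun T >-> R}.

Definition zero_set (g : M) : set T := [set x | g x = 0].

Definition zero_sets (I : ideal M) : set (set T) := [set zero_set g | g in I].

Context (mu : {measure set T -> \bar R}) (I : ideal M).

(* The sets Z \ E with Z in Z[I], E a subset of Z and mu(E) = 0. *)
Definition full_subsets : set (set T) :=
  [set A | exists Z E, [/\ zero_sets I Z, measurable E, E `<=` Z,
                           mu E = 0%E & A = Z `\` E]].

(* U_{mu_I}^+, m_{mu_I}(f, u) and U_{mu_I}(f, e) respectively. *)
Definition m_units : set M :=
  [set u | exists2 A, full_subsets A & forall x, A x -> 0 < u x].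

Definition m_ball (f u : M) : set M :=
  [set g | exists2 A, full_subsets A & forall x, A x -> `|g x - f x| < u x].

(* The supremum is taken in [0, +oo]: adding 0 only matters when A is empty,
   where [ereal_sup] alone would give -oo. *)
Definition U_ball (f : M) (e : R) : set M :=
  [set g | exists2 A, full_subsets A &
     (ereal_sup (0%E |` [set `|f x - g x|%:E | x in A]) < e%:E)%E].

Lemma measurable_zero_set g : measurable (zero_set g).
Proof.
have := @measurable_funPTI _ _ _ _ g _ (measurable_set1 (0 : R)).
by [].
Qed.

Lemma full_subsetsT : exists A, full_subsets A.
Proof.
exists (zero_set 0 `\` set0), (zero_set 0), set0; split=> //.
by exists 0 => //; exact: ideal_0.
Qed.

Lemma zero_setsI Z1 Z2 :
  zero_sets I Z1 -> zero_sets I Z2 -> zero_sets I (Z1 `&` Z2).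
Proof.
move=> [g1 Ig1 <-] [g2 Ig2 <-]; exists (g1 * g1 + g2 * g2).
  by apply: ideal_D; apply: ideal_M.
have gE x : (g1 * g1 + g2 * g2) x = g1 x ^+ 2 + g2 x ^+ 2 by [].
apply/seteqP; split=> x; rewrite /zero_set; last first.
  by move=> [g1x g2x]; apply: etrans (gE x) _; rewrite g1x g2x expr0n addr0.
move=> gx0; have /eqP := etrans (esym (gE x)) gx0.
by rewrite paddr_eq0 ?sqr_ge0// !sqrf_eq0 => /andP[/eqP ? /eqP ?].
Qed.

Lemma full_subsetsI A B :
  full_subsets A -> full_subsets B -> full_subsets (A `&` B).
Proof.
move=> [Z1 [E1 [Z1I mE1 E1Z1 E10 ->]]] [Z2 [E2 [Z2I mE2 E2Z2 E20 ->]]].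
have mZ Z : zero_sets I Z -> measurable Z.
  by move=> [g _ <-]; exact: measurable_zero_set.
exists (Z1 `&` Z2), ((E1 `|` E2) `&` (Z1 `&` Z2)); split.
- exact: zero_setsI.
- by apply: measurableI; [exact: measurableU|apply: measurableI; exact: mZ].
- by move=> x [].
- have mE : measurable (E1 `|` E2) by exact: measurableU.
  apply: (@subset_measure0 _ _ _ mu _ (E1 `|` E2)) => //.
  + by apply: measurableI => //; apply: measurableI; exact: mZ.
  + apply/eqP; rewrite eq_le measure_ge0 andbT.
    have := measureU2 mu mE1 mE2.
    by rewrite -[leRHS]/(mu E1 + mu E2)%E E10 E20 adde0.
- apply/seteqP; split=> x /=; tauto.
Qed.

Lemma m_cover :
  \bigcup_(p in [set p : M * M | m_units p.2]) m_ball p.1 p.2 = [set: M].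
Proof.
apply/seteqP; split=> // f _; have [A AI] := full_subsetsT.
exists (f, 1 : M) => /=; first by exists A => // x _; exact: ltr01.
by exists A => // x _; rewrite subrr normr0; exact: ltr01.
Qed.

Lemma m_join (p q : M * M) (t : M) : m_units p.2 -> m_units q.2 ->
  m_ball p.1 p.2 t -> m_ball q.1 q.2 t ->
  exists r : M * M, [/\ m_units r.2, m_ball r.1 r.2 t &
    m_ball r.1 r.2 `<=` m_ball p.1 p.2 `&` m_ball q.1 q.2].
Proof.
move: p q => [f1 u1] [f2 u2] /= _ _ [A AI tA] [B BI tB].
pose v x := Num.min (u1 x - `|t x - f1 x|) (u2 x - `|t x - f2 x|).
have mv : measurable_fun setT v.
  apply: measurable_minr; apply: measurable_funB => //;
  by apply: measurableT_comp => //; exact: measurable_funB.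
pose vM : M := mfun_Sub (mem_set mv).
have vME x : vM x = v x by [].
have v0 x : (A `&` B) x -> 0 < v x.
  by move=> [/tA ? /tB ?]; rewrite lt_min !subr_gt0; apply/andP.
exists (t, vM); split=> /=.
- by exists (A `&` B); [exact: full_subsetsI|exact: v0].
- exists (A `&` B); first exact: full_subsetsI.
  by move=> x ABx; rewrite subrr normr0 vME; exact: v0.
- have tri (g f u : M) x : `|g x - t x| < u x - `|t x - f x| ->
    `|g x - f x| < u x.
    rewrite ltrBrDr; apply: le_lt_trans.
    by rewrite -(subrKA (t x)) ler_normD.
  move=> g [C CI gC]; split; exists C => // x /gC;
    rewrite vME lt_min => /andP[g1 g2]; exact: tri.
Qed.

Lemma U_cover :
  \bigcup_(p in [set p : M * R | 0 < p.2]) U_ball p.1 p.2 = [set: M].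
Proof.
apply/seteqP; split=> // f _; have [A AI] := full_subsetsT.
exists (f, 1) => //=; exists A => //.
apply: (@le_lt_trans _ _ 0%E); last by rewrite lte_fin.
by apply: ge_ereal_sup => _ [->//|[x _ <-]]; rewrite subrr normr0.
Qed.

Lemma U_ballP f e g : U_ball f e g <-> exists A s,
  [/\ full_subsets A, 0 <= s < e & forall x, A x -> `|f x - g x| <= s].
Proof.
split=> [[A AI]|[A [s [AI /andP[s0 se] As]]]]; last first.
  exists A => //; apply: (@le_lt_trans _ _ s%:E); last by rewrite lte_fin.
  apply: ge_ereal_sup => _ [->|[x Ax <-]]; rewrite lee_fin//.
  exact: As.
set S := (_ |` _); move=> Se; exists A, (fine (ereal_sup S)).
have S0 : (0 <= ereal_sup S)%E by apply: ereal_sup_ubound; left.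
have Sfin : ereal_sup S \is a fin_num.
  by rewrite ge0_fin_numE// (lt_trans Se)// ltry.
split=> //; first by rewrite fine_ge0//= -lte_fin fineK.
move=> x Ax; rewrite -lee_fin fineK//.
by apply: ereal_sup_ubound; right; exists x.
Qed.

Lemma U_join (p q : M * R) (t : M) : 0 < p.2 -> 0 < q.2 ->
  U_ball p.1 p.2 t -> U_ball q.1 q.2 t ->
  exists r : M * R, [/\ 0 < r.2, U_ball r.1 r.2 t &
    U_ball r.1 r.2 `<=` U_ball p.1 p.2 `&` U_ball q.1 q.2].
Proof.
move: p q => [f1 e1] [f2 e2] /= _ _.
move=> /U_ballP[A [s1 [AI /andP[s10 s1e] As]]].
move=> /U_ballP[B [s2 [BI /andP[s20 s2e] Bs]]].
exists (t, Num.min (e1 - s1) (e2 - s2)) => /=.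
have e0 : 0 < Num.min (e1 - s1) (e2 - s2) by rewrite lt_min !subr_gt0 s1e.
split=> //.
  apply/U_ballP; exists A, 0; split=> //; first by rewrite lexx.
  by move=> x _; rewrite subrr normr0.
move=> g /U_ballP[C [s [CI /andP[s0]]]].
rewrite lt_min => /andP[se1 se2] Cs.
have tri (f : M) (s' : R) D x : (forall x, D x -> `|f x - t x| <= s') ->
    (D `&` C) x -> `|f x - g x| <= s' + s.
  move=> Ds [/Ds Dx /Cs Cx]; rewrite -(subrKA (t x)).
  by rewrite (le_trans (ler_normD _ _))// lerD.
split; apply/U_ballP.
- exists (A `&` C), (s1 + s); split; first exact: full_subsetsI.
    by rewrite addr_ge0//= addrC -ltrBrDr.
  by move=> x; apply: tri.
- exists (B `&` C), (s2 + s); split; first exact: full_subsetsI.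
    by rewrite addr_ge0//= addrC -ltrBrDr.
  by move=> x; apply: tri.
Qed.

End zero_sets.

Section topologies.
Context d (T : measurableType d) (R : realType).
Local Notation M := {mfun T >-> R}.
Implicit Types (mu : {measure set T -> \bar R}) (I : ideal M).

(* Required by the index type of [isBaseTopological]. *)
HB.instance Definition _ := isPointed.Build M 0.

Definition m_space mu I : Type := M.
HB.instance Definition _ mu I := Choice.on (m_space mu I).
HB.instance Definition _ mu I :=
  @isBaseTopological.Build (m_space mu I) (M * M)%type
    [set p | m_units mu I p.2] (fun p => m_ball mu I p.1 p.2)
    (m_cover mu I) (@m_join _ T R mu I).

Definition U_space mu I : Type := M.
HB.instance Definition _ mu I := Choice.on (U_space mu I).
HB.instance Definition _ mu I :=
  @isBaseTopological.Build (U_space mu I) (M * R)%type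
    [set p | 0 < p.2] (fun p => U_ball mu I p.1 p.2)
    (U_cover mu I) (@U_join _ T R mu I).

End topologies.

Section ideals.
Context d (T : measurableType d) (R : realType).
Local Notation M := {mfun T >-> R}.
Context (mu : {measure set T -> \bar R}).

Definition positive_ideals : set (ideal M) :=
  [set I | forall E, zero_sets I E -> (0 < mu E)%E].

Definition m_equiv (I J : ideal M) : Prop :=
  (open : set (set (m_space mu I))) = (open : set (set (m_space mu J))).

Definition U_equiv (I J : ideal M) : Prop :=
  (open : set (set (U_space mu I))) = (open : set (set (U_space mu J))).

End ideals.

(* Main.v *)
Require Import Defs.
From HB Require Import structures.
From mathcomp Require Import all_boot all_order all_algebra.
From mathcomp Require Import all_classical all_reals all_analysis.
From mathcomp Require Import measurable_realfun.
Set Implicit Arguments.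
Unset Strict Implicit.
Unset Printing Implicit Defensive.
Import Order.TTheory GRing.Theory Num.Theory.
Local Open Scope classical_set_scope.
Local Open Scope ring_scope.

(** The Dirac measure cannot see anything outside [x0].  If every zero set of
    an ideal [I] has positive Dirac measure, then [x0] lies in every [Z] of
    [Z[I]] and in no null set [E], so each [Z `\` E] contains [x0]; and since
    [Z `\` [set x0]] is itself null, [E] can be chosen so that [Z `\` E] is
    exactly [[set x0]].  Hence a condition holds throughout some [Z `\` E] if
    and only if it holds at [x0] ([full_subsets_dirac]).  The conditions that
    define the basic open sets of both topologies have this form, so the basic
    sets are determined by values at [x0] alone: the [m]-ball of radius [u]
    around [f] is [`|g x0 - f x0| < u x0], with the admissible [u] being those
    with [0 < u x0], and the [U]-ball of radius [e] is [`|f x0 - g x0| < e].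
    As [I] has disappeared from these descriptions, two such ideals have the
    same bases, hence the same topologies. *)

Section equal_bases.
Context d (T : measurableType d) (R : realType).
Local Notation M := {mfun T >-> R}.
Context (mu : {measure set T -> \bar R}) (I J : ideal M).

(** The open sets are by construction the unions of basic sets, so they depend
    on the ideal only through the base. *)
Lemma eq_m_equiv :
  m_units mu I = m_units mu J -> m_ball mu I = m_ball mu J -> m_equiv mu I J.
Proof.
move=> unitsE ballE.
have openE (K : ideal M) : (open : set (set (m_space mu K))) =
    [set \bigcup_(p in D) m_ball mu K p.1 p.2 | D in
      subset^~ [set p : M * M | m_units mu K p.2]] by [].
by rewrite /m_equiv !openE unitsE ballE.
Qed.

Lemma eq_U_equiv : U_ball mu I = U_ball mu J -> U_equiv mu I J.
Proof.
move=> ballE.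
have openE (K : ideal M) : (open : set (set (U_space mu K))) =
    [set \bigcup_(p in D) U_ball mu K p.1 p.2 | D in
      subset^~ [set p : M * R | 0 < p.2]] by [].
by rewrite /U_equiv !openE ballE.
Qed.

End equal_bases.

Section dirac.
Context d (T : measurableType d) (R : realType) (x0 : T).
Local Notation M := {mfun T >-> R}.
Context (mx0 : measurable [set x0]).

Lemma dirac_gt0 (E : set T) : (0 < \d_x0 E :> \bar R)%E <-> E x0.
Proof.
rewrite diracE lte_fin ltr0n lt0b.
by split=> [/set_mem|/mem_set].
Qed.

Lemma dirac_eq0 (E : set T) : \d_x0 E = 0%E :> \bar R <-> ~ E x0.
Proof.
rewrite diracE; split=> [+ /mem_set Ex0|Ex0]; last by rewrite memNset.
by rewrite Ex0 => -[] /eqP; rewrite oner_eq0.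
Qed.

Context (I : ideal M) (I_pos : positive_ideals \d_x0 I).

(** Positivity of [I] forces [x0] into every [Z `\` E]; conversely, removing
    from [Z] everything except [x0] removes only a null set, which is measurable
    because [[set x0]] is. *)
Lemma full_subsets_dirac (P : T -> Prop) :
  (exists2 A, full_subsets \d_x0 I A & forall x, A x -> P x) <-> P x0.
Proof.
split=> [[A [Z [E [ZI _ _ E0 ->]]] AP]|Px0].
  by apply: AP; split; [apply/dirac_gt0/I_pos|apply/dirac_eq0].
(* Any [Z] in [Z[I]] will do: the zero function lies in every ideal. *)
pose Z := zero_set (0 : M).
have ZI : zero_sets I Z by exists 0 => //; exact: ideal_0.
exists (Z `\` (Z `\` [set x0])); last by move=> x [Zx /not_andP[//|/contrapT ->]].
exists Z, (Z `\` [set x0]); split=> //.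
- by apply: measurableD => //; exact: measurable_zero_set.
- by apply/dirac_eq0 => -[_]; exact.
Qed.

Lemma m_units_dirac : m_units \d_x0 I = [set u | 0 < u x0].
Proof.
by apply/funext => u; apply/propext; exact: full_subsets_dirac.
Qed.

Lemma m_ball_dirac :
  m_ball \d_x0 I = fun f u => [set g | `|g x0 - f x0| < u x0].
Proof.
apply/funext => f; apply/funext => u; apply/funext => g; apply/propext.
exact: (full_subsets_dirac (fun x => `|g x - f x| < u x)).
Qed.

(** A supremum below [e] means a uniform bound [s] with [s < e]; since one
    point decides, the best such [s] is the value [`|f x0 - g x0|]. *)
Lemma U_ball_dirac :
  U_ball \d_x0 I = fun f e => [set g | `|f x0 - g x0| < e].
Proof.
apply/funext => f; apply/funext => e; apply/funext => g; apply/propext.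
have ballP s := full_subsets_dirac (fun x => `|f x - g x| <= s).
split=> [/U_ballP[A [s [AI /andP[_ s_lt_e] As]]]|fg_lt_e].
  by apply: le_lt_trans s_lt_e; apply/ballP; exists A.
have [A AI As] := (ballP `|f x0 - g x0|).2 (lexx _).
by apply/U_ballP; exists A, `|f x0 - g x0|; rewrite normr_ge0.
Qed.

End dirac.

Theorem theorem4p6 (R : realType) (X : pointedType)
    (X_infinite : infinite_set [set: X]) (x0 : power_space X)
    (I J : ideal {mfun power_space X >-> R})
    (I_pos : positive_ideals \d_x0 I) (J_pos : positive_ideals \d_x0 J) :
  m_equiv \d_x0 I J /\ U_equiv \d_x0 I J.
Proof.
have mx0 : measurable [set x0] by [].
split; first by apply: eq_m_equiv; rewrite ?m_units_dirac ?m_ball_dirac.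
by apply: eq_U_equiv; rewrite !U_ball_dirac.
Qed.
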